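(* There is an absolute constant $C>0$ such that for every finite convex set $A\subseteq\mathbb{R}$ with $|A|\ge 2$ one has $$\mathsf{E}(A)\le C\,|A|^{\frac{32}{13}}\,(\log |A|)^{\frac{71}{65}} .$$
   Context: A finite set $A=\{a_1<a_2<\dots<a_n\}\subseteq\mathbb{R}$ is called convex if $a_i-a_{i-1}<a_{i+1}-a_i$ for every $2\le i\le n-1$. The additive energy $\mathsf{E}(A)$ is the number of quadruples $(a_1,a_2,a_3,a_4)\in A^4$ with $a_1-a_2=a_3-a_4$. Logarithms are to base $2$. *)

(* Defs.v *)
From HB Require Import structures.
From mathcomp Require Import all_boot all_order all_algebra finmap.
From mathcomp Require Import reals exp.

Set Implicit Arguments.
Unset Strict Implicit.
Unset Printing Implicit Defensive.

Import Order.TTheory GRing.Theory Num.Theory.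
Local Open Scope fset_scope.
Local Open Scope ring_scope.

(* Enumeration of A from its least to its greatest element, indexed from 0;
   the junk value for i >= #|` A| is 0. *)
Definition fset_elt (R : realType) (A : {fset R}) (i : nat) : R :=
  nth 0 (sort <=%R (enum_fset A)) i.

Definition convex_fset (R : realType) (A : {fset R}) : Prop :=
  forall i : nat, (1 <= i)%N -> (i.+1 < #|` A|)%N ->
    fset_elt A i - fset_elt A i.-1 < fset_elt A i.+1 - fset_elt A i.

(* A quadruple (a1, a2, a3, a4) is encoded as ((a1, a2), (a3, a4)). *)
Definition additive_energy (R : realType) (A : {fset R}) : nat :=
  #|` [fset q in (A `*` A) `*` (A `*` A)
        | q.1.1 - q.1.2 == q.2.1 - q.2.2] |.

Definition log2 (R : realType) (x : R) : R := ln x / ln 2.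

(* Main.v *)
(* Write r(d) for the number of representations of d as a difference in A, n = |A|, and E, E3 for
   the sums of r^2, r^3.
   1. If A is convex and B is any finite set, then at most O(n |B|^2 / t^3) elements have at least t
      representations in A + B (Garaev): the representations of x form a monotone chain in A x B, so
      many of them have another one close by in both coordinates, and by convexity a pair of
      representations is determined by one element of B and the two index gaps.  In particular
      E3 = O(n^3 log n).
   2. Let T be the operator on functions on A with kernel r(x - z), and T' the one with kernel
      r1(x - y), where r1 is r restricted to the d with r(d) <= 2 E3 / E; r1 still carries half of
      E.  As T is positive semidefinite and T >= T' entrywise, Q = tr (T T'^2) satisfies
      E^3 = O(n^3 Q).
   3. Sorting the triples of A counted by Q by their differences a = x - y, b = z - y, Cauchy-
      Schwarz gives Q^2 <= E3 X, where X sums r1(a)^2 r1(b)^2 r(a - b)^2.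
   4. Order the three differences so that the first has the smallest r; it is at most 2 E3 / E.
      Expanding one factor r of the smallest into pairs of A turns the sum into an energy between A
      and the level sets of r, to which 1. applies, so that up to logarithms
      X = O(n^(11/2) (E3 / E)^(1/2)).
   Together E^13 = O(n^32 log^10 n). *)
Require Import Defs.
From HB Require Import structures.
From mathcomp Require Import all_boot all_order all_algebra finmap.
From mathcomp Require Import zify ring lra.
From mathcomp Require Import reals exp.

Set Implicit Arguments.
Unset Strict Implicit.
Unset Printing Implicit Defensive.

Import Order.TTheory GRing.Theory Num.Theory.
Local Open Scope fset_scope.
Local Open Scope ring_scope.

(** * Sums of natural numbers: Cauchy-Schwarz, fibres, dyadic scales, collisions *)

Section NatSums.
Local Open Scope nat_scope.

Lemma leq_sum_seq (I : eqType) (s : seq I) (F G : I -> nat) :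
  {in s, forall i, F i <= G i} -> \sum_(i <- s) F i <= \sum_(i <- s) G i.
Proof. by move=> FG; rewrite [X in X <= _]big_seq [X in _ <= X]big_seq leq_sum. Qed.

Lemma leq_sum_term (I : eqType) (s : seq I) (F : I -> nat) (i : I) :
  i \in s -> F i <= \sum_(j <- s) F j.
Proof. by move=> si; rewrite (big_rem i) //= leq_addr. Qed.

Lemma sum_nat_le_const (I : Type) (s : seq I) (F : I -> nat) (c : nat) :
  (forall i, F i <= c) -> \sum_(i <- s) F i <= size s * c.
Proof.
by move=> Fc; rewrite -sum1_size big_distrl /=; apply: leq_sum => i _; rewrite mul1n.
Qed.

Lemma sum_nat_Cauchy_le (I : Type) (s : seq I) (m u v : I -> nat) :
  (forall i, m i ^ 2 <= u i * v i) ->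
  (\sum_(i <- s) m i) ^ 2 <= (\sum_(i <- s) u i) * (\sum_(i <- s) v i).
Proof.
move=> muv; elim: s => [|a s IH]; first by rewrite !big_nil.
rewrite !big_cons; move: (muv a) IH.
move: (m a) (u a) (v a) (\sum_(i <- s) _) (\sum_(i <- s) _) (\sum_(i <- s) _).
move=> x y z W U S xyz SUW.
(* The cross term of the expanded square, by the AM-GM inequality for [y * W] and [z * U]. *)
have key : 2 * (x * S) <= y * W + z * U.
  rewrite -leq_sqr; apply: leq_trans (nat_AGM2 (y * W) (z * U)).1.
  rewrite (_ : (2 * (x * S)) ^ 2 = 4 * (x ^ 2 * S ^ 2)); last by ring.
  rewrite (_ : y * W * (z * U) = y * z * (U * W)); last by ring.
  by rewrite leq_mul2l /= leq_mul.
nia.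
Qed.

Lemma sum_nat_Cauchy (I : Type) (s : seq I) (u v : I -> nat) :
  (\sum_(i <- s) u i * v i) ^ 2 <=
    (\sum_(i <- s) u i ^ 2) * (\sum_(i <- s) v i ^ 2).
Proof. by apply: sum_nat_Cauchy_le => i; rewrite expnMn. Qed.

Lemma sum_nat_Cauchy1 (I : Type) (s : seq I) (u : I -> nat) :
  (\sum_(i <- s) u i) ^ 2 <= size s * \sum_(i <- s) u i ^ 2.
Proof.
have := sum_nat_Cauchy s u (fun=> 1); rewrite mulnC.
under eq_bigr do rewrite muln1.
by rewrite -(sum1_size s).
Qed.

Lemma sum_fiber (T : eqType) (X : seq T) (y : T) (G : T -> nat) :
  uniq X -> \sum_(x <- X) (y == x) * G x = (y \in X) * G y.
Proof.
elim: X => [|x X IH] /=; first by rewrite big_nil.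
case/andP=> xX uX; rewrite big_cons IH // in_cons.
have [->|_] := eqVneq y x; last by [].
by rewrite (negPf xX) addn0.
Qed.

Lemma sum_fiber1 (T : eqType) (X : seq T) (y : T) :
  uniq X -> \sum_(x <- X) (y == x) = (y \in X).
Proof.
move=> uX; have := sum_fiber y (fun=> 1) uX.
by under eq_bigr do rewrite muln1; rewrite muln1.
Qed.

(** The double count behind every energy below: pairs with equal image are sorted by their common
    value. [X] has to contain only the values taken at points of positive weight. *)
Lemma sum_fiber_sq (I T : eqType) (s : seq I) (X : seq T) (u : I -> nat)
    (phi : I -> T) :
  uniq X -> {in s, forall i, 0 < u i -> phi i \in X} ->
  \sum_(i <- s) \sum_(j <- s) u i * u j * (phi i == phi j) =
  \sum_(x <- X) (\sum_(i <- s) u i * (phi i == x)) ^ 2.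
Proof.
move=> uX sX; under [RHS]eq_bigr => x _.
  rewrite expnS expn1 big_distrlr /=.
  over.
rewrite [RHS]exchange_big /= big_seq [RHS]big_seq; apply: eq_bigr => i si.
rewrite [RHS]exchange_big /=; apply: eq_bigr => j _.
have [u0|upos] := posnP (u i).
  by rewrite big1 ?u0 // => x _; rewrite u0.
transitivity (\sum_(x <- X) (phi i == x) * (u i * u j * (phi j == x))); last first.
  by apply: eq_bigr => x _; ring.
by rewrite sum_fiber // sX // mul1n [phi j == _]eq_sym.
Qed.

Lemma sum_nat_pred (I : Type) (s : seq I) (P : pred I) : \sum_(i <- s) P i = count P s.
Proof. by rewrite -sum1_count [RHS]big_mkcond; apply: eq_bigr => i _; case: (P i). Qed.

(** The single term with j = [trunc_log 2 m] already dominates, since m < 2^(j+1). The factor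
    [(i <= j)] keeps the lower bound on m for later use. *)
Lemma expn_le_dyadic (p i J m : nat) : 2 ^ i <= m < 2 ^ J ->
  m ^ p <= \sum_(j <- iota 0 J) (i <= j) * (2 ^ j <= m) * (2 ^ p) ^ j.+1.
Proof.
case/andP=> im mJ; have m0 : 0 < m by apply: leq_trans im; rewrite expn_gt0.
have /andP[jm mj] := trunc_log_bounds (isT : 1 < 2) m0.
have jJ : trunc_log 2 m \in iota 0 J.
  by rewrite mem_iota /= add0n -(ltn_exp2l _ _ (isT : 1 < 2)) (leq_ltn_trans jm).
apply: leq_trans (leq_sum_term _ jJ).
rewrite jm (trunc_log_max _ im) // !mul1n -expnM mulnC expnM.
by case: p => [|p]; rewrite ?expn0 // leq_exp2r // ltnW.
Qed.

(** If k_t of the selected points have colour t, the squares k_t^2 sum to the collisions plus the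
    diagonal; adding 2 k_t <= k_t^2 + 1 over the q colours gives the claim. *)
Lemma count_collisions (I : eqType) (s : seq I) (P : pred I) (c : I -> nat) (q : nat) :
  uniq s -> {in s, forall i, P i -> c i < q} ->
  \sum_(i <- s) P i <=
    \sum_(i <- s) \sum_(j <- s) P i * P j * (c i == c j) * (i != j) + q.
Proof.
move=> us cq; set k := \sum_(i <- s) P i; set N := (X in _ <= X + _).
have split_diag : \sum_(i <- s) \sum_(j <- s) P i * P j * (c i == c j) = N + k.
  rewrite /N /k -big_split /= big_seq [RHS]big_seq; apply: eq_bigr => i si.
  have Pi : nat_of_bool (P i) = \sum_(j <- s) (i == j) * P j by rewrite sum_fiber // si mul1n.
  rewrite [X in _ = _ + X]Pi -big_split /=.
  apply: eq_bigr => j _; have [->|_] := eqVneq i j; last by rewrite muln1 addn0.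
  by rewrite eqxx; case: (P j).
have sum_sq : N + k + q = \sum_(t <- iota 0 q) ((\sum_(i <- s) P i * (c i == t)) ^ 2 + 1).
  rewrite big_split /= sum1_size size_iota -split_diag; congr (_ + _).
  apply: (sum_fiber_sq (iota_uniq 0 q)) => i si.
  by rewrite mem_iota lt0b /= add0n; apply: cq.
have sum_k : 2 * k = \sum_(t <- iota 0 q) 2 * \sum_(i <- s) P i * (c i == t).
  rewrite -big_distrr /= exchange_big /=; congr (_ * _).
  rewrite /k big_seq [RHS]big_seq; apply: eq_bigr => i si.
  rewrite -big_distrr /= sum_fiber1 ?iota_uniq // mem_iota /= add0n.
  by case: (boolP (P i)) => // Pi; rewrite (cq i si Pi).
suff: 2 * k <= N + k + q by lia.
rewrite sum_k sum_sq; apply: leq_sum => t _.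
by have := (nat_Cauchy (\sum_(i <- s) P i * (c i == t)) 1).1; rewrite muln1.
Qed.

End NatSums.

(** * Representation counts in sumsets *)

Definition rep (V : zmodType) (A B : seq V) (x : V) : nat :=
  (\sum_(a <- A) \sum_(b <- B) (a + b == x)%R)%N.

Lemma rep_mem (V : zmodType) (A B : seq V) (x : V) :
  uniq B -> rep A B x = (\sum_(a <- A) (x - a \in B)%R)%N.
Proof.
move=> uB; apply: eq_bigr => a _; rewrite -(sum_fiber1 _ uB).
by apply: eq_bigr => b _; rewrite subr_eq addrC eq_sym.
Qed.

Lemma repC (V : zmodType) (A B : seq V) (x : V) : rep A B x = rep B A x.
Proof.
by rewrite /rep exchange_big; do 2!apply: eq_bigr => ? _; rewrite addrC.
Qed.

Lemma rep_le_size (V : zmodType) (A B : seq V) (x : V) :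
  uniq B -> (rep A B x <= size A)%N.
Proof.
by move=> uB; rewrite rep_mem // -sum1_size; apply: leq_sum => a _; apply: leq_b1.
Qed.

Lemma sum_rep_le (V : zmodType) (A B X : seq V) :
  uniq X -> (\sum_(x <- X) rep A B x <= size A * size B)%N.
Proof.
move=> uX; rewrite /rep exchange_big -sum1_size big_distrl; apply: leq_sum => a _.
rewrite exchange_big /= mul1n -sum1_size; apply: leq_sum => b _.
by rewrite sum_fiber1 // leq_b1.
Qed.

(** * Garaev's incidence bound for convex sequences *)

Section ConvexIncidence.
Variables (R : realDomainType) (f : nat -> R) (n : nat).
Hypothesis f_mono : forall i j, (i < j < n)%N -> f i < f j.
Hypothesis f_convex : forall i, (i.+2 < n)%N -> f i.+1 - f i < f i.+2 - f i.+1.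

Lemma convex_step (i j : nat) : (i < j)%N -> (j.+1 < n)%N ->
  f i.+1 - f i < f j.+1 - f j.
Proof.
elim: j => // j IH; rewrite ltnS leq_eqVlt => /predU1P[->|ij] jn.
  exact: f_convex.
by apply: lt_trans (IH ij (ltnW jn)) _; apply: f_convex.
Qed.

Lemma convex_gap (i j l : nat) : (i < j)%N -> (j + l.+1 < n)%N ->
  f (i + l.+1)%N - f i < f (j + l.+1)%N - f j.
Proof.
move=> ij; elim: l => [|l IH] jn; first by rewrite !addn1 convex_step // -addn1.
have := IH (ltac:(lia)); have := @convex_step (i + l.+1)%N (j + l.+1)%N.
rewrite !(addnS _ l.+1) => /(_ (ltac:(lia)) (ltac:(lia))); lra.
Qed.

(** For a fixed index gap, the difference of values strictly increases with the starting index. *)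
Lemma convex_gap_inj (i j i' j' : nat) :
  (i < j < n)%N -> (i' < j' < n)%N -> (j - i = j' - i')%N ->
  f j - f i = f j' - f i' -> i = i'.
Proof.
move=> /andP[ij jn] /andP[ij' jn'] eql eqf.
have [l jl] : exists l, (j - i = l.+1)%N by exists (j - i).-1; lia.
have Ej : j = (i + l.+1)%N by lia.
have Ej' : j' = (i' + l.+1)%N by lia.
subst j j'.
case: (ltngtP i i') => // lt_i; have := convex_gap lt_i.
  by move=> /(_ _ jn'); rewrite eqf ltxx.
by move=> /(_ _ jn); rewrite eqf ltxx.
Qed.

(** The sign of [f j - f i] reveals the order of i and j, so the unsigned gap suffices. With
    truncated subtraction, [(i - j) + (j - i)] is |i - j|. *)
Lemma convex_dist_inj (i j i' j' : nat) : i != j ->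
  (i < n)%N -> (j < n)%N -> (i' < n)%N -> (j' < n)%N ->
  ((i - j) + (j - i) = (i' - j') + (j' - i'))%N ->
  f j - f i = f j' - f i' -> i = i' /\ j = j'.
Proof.
move=> nij i_n jn i_n' jn' eql eqf.
have ij' : i' != j' by apply/eqP => E; move: eql; rewrite E; lia.
case: (ltngtP i j) nij => // lt_ij _; case: (ltngtP i' j') ij' => // lt_ij' _.
- have E : i = i' by apply: (@convex_gap_inj i j i' j') => //; lia.
  by split=> //; lia.
- have := @f_mono i j; have := @f_mono j' i'; rewrite lt_ij jn lt_ij' i_n'.
  move=> /(_ isT) h /(_ isT) h'; exfalso; clear eql; lra.
- have := @f_mono j i; have := @f_mono i' j'; rewrite lt_ij i_n lt_ij' jn'.
  move=> /(_ isT) h /(_ isT) h'; exfalso; clear eql; lra.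
- have E : j = j'.
    by apply: (@convex_gap_inj j i j' i'); [lia|lia|lia|lra].
  by split=> //; lia.
Qed.

Variables (B X : seq R).
Hypothesis (uB : uniq B) (uX : uniq X).

(** A rank counted from the top, so that [above (x - f i)] grows with i. *)
Let above (b : R) : nat := count (fun y => b < y) B.

Let above_anti (b b' : R) : b <= b' -> (above b' <= above b)%N.
Proof. by move=> bb'; apply: sub_count => y /=; apply: le_lt_trans. Qed.

Let above_lt (b b' : R) : b' \in B -> b < b' -> (above b' < above b)%N.
Proof.
move=> Bb' bb'.
have -> : above b = (count (fun y => (b < y <= b')%R) B + above b')%N.
  rewrite /above -!sumn_count !sumnE !big_map -big_split /=; apply: eq_bigr => y _.
  by case: (leP y b') => h; rewrite ?andbF ?andbT /= ?addn0 // (lt_trans bb' h).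
by rewrite -[X in (X < _)%N]add0n ltn_add2r -has_count; apply/hasP; exists b'; rewrite ?bb' /=.
Qed.

Let above_inj : {in B &, injective above}.
Proof.
move=> b b' Bb Bb' eqa; case: (ltgtP b b') => // h.
  by have := above_lt Bb' h; rewrite eqa ltnn.
by have := above_lt Bb h; rewrite eqa ltnn.
Qed.

Let above_size (b : R) : b \in B -> (above b < size B)%N.
Proof.
move=> Bb; rewrite -(count_predC (fun y => b < y) B) -[X in (X < _)%N]addn0.
by rewrite ltn_add2l -has_count; apply/hasP; exists b; rewrite //= ltxx.
Qed.

Section Blocks.
Variables u v : nat.
Hypotheses (u_gt0 : (0 < u)%N) (v_gt0 : (0 < v)%N).

(* Both summands are monotone in [i], so equal values of [block x] mean equal summands. *)
Let block (x : R) (i : nat) : nat := (i %/ u + above (x - f i) %/ v)%N.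

Let collide (x : R) (i j : nat) : bool :=
  [&& x - f i \in B, x - f j \in B, block x i == block x j & i != j].

Let collideP (x : R) (i j : nat) : (i < n)%N -> (j < n)%N -> collide x i j ->
  (i %/ u = j %/ u /\ above (x - f i) %/ v = above (x - f j) %/ v)%N.
Proof.
have key (i' j' : nat) : (i' < n)%N -> (j' < n)%N -> (i' < j')%N ->
    block x i' = block x j' ->
    (i' %/ u = j' %/ u /\ above (x - f i') %/ v = above (x - f j') %/ v)%N.
  move=> i'n j'n lt_ij.
  have := leq_div2r u (ltnW lt_ij).
  have := @above_anti (x - f j') (x - f i').
  rewrite lerD2l lerN2 ltW ?f_mono ?lt_ij // => /(_ isT) /(leq_div2r v).
  rewrite /block; lia.
move=> i_n jn /and4P[_ _ /eqP eqb]; case: (ltngtP i j) => // h _.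
  exact: key.
by have [] := key j i jn i_n h (esym eqb).
Qed.

Let collisions : seq (R * (nat * nat)) :=
  [seq p <- [seq (x, ij) | x <- X, ij <- [seq (i, j) | i <- iota 0 n, j <- iota 0 n]]
     | collide p.1 p.2.1 p.2.2].

(** A collision is encoded by x - f i in B, the rank of x - f j modulo v, and |i - j| < u. The
    shared block restores the full rank, hence x - f j; then f j - f i and the index gap determine i
    and j by convexity, and so x. *)
Let size_collisions : (size collisions <= size B * (v * u))%N.
Proof.
pose code (p : R * (nat * nat)) : R * (nat * nat) :=
  (p.1 - f p.2.1,
    (above (p.1 - f p.2.2)%R %% v, (p.2.1 - p.2.2) + (p.2.2 - p.2.1))%N).
pose codes := [seq (b, wl) | b <- B, wl <- [seq (w, l) | w <- iota 0 v, l <- iota 0 u]].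
have mem_coll p : p \in collisions ->
    [/\ (p.2.1 < n)%N, (p.2.2 < n)%N & collide p.1 p.2.1 p.2.2].
  rewrite mem_filter => /andP[h /allpairsP[[x ij] /= [_ /allpairsP[[i j] /= []]]]].
  by rewrite !mem_iota /= => i_n jn -> E; rewrite E in h *.
have -> : (size B * (v * u))%N = size codes by rewrite !size_allpairs !size_iota.
rewrite -(size_map code); apply: uniq_leq_size.
  rewrite map_inj_in_uniq.
    by rewrite filter_uniq // !allpairs_uniq ?iota_uniq // => -[? ?] [? ?].
  move=> [x [i j]] [x' [i' j']] /mem_coll[/= i_n jn h] /mem_coll[/= i_n' jn' h'].
  have [_ eqv] := collideP i_n jn h; have [_ eqv'] := collideP i_n' jn' h'.
  case=> eqb eqw eql.
  have eqa : above (x - f j) = above (x' - f j').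
    by rewrite (divn_eq (above (x - f j)) v) -eqv eqb eqv' eqw -divn_eq.
  case/and4P: h => xi xj _ nij; case/and4P: h' => xi' xj' _ _.
  have eqb' := above_inj xj xj' eqa.
  have [Ei Ej] : i = i' /\ j = j'.
    by apply: convex_dist_inj => //; lra.
  have -> : x = x' by move: eqb; rewrite Ei; lra.
  by rewrite Ei Ej.
move=> q /mapP[[x [i j]] /mem_coll[/= i_n jn h] ->].
have [equ _] := collideP i_n jn h.
case/and4P: h => xi _ _ _.
apply/allpairsP; exists (x - f i, (above (x - f j)%R %% v, (i - j) + (j - i))%N); split=> //=.
apply/allpairsP; exists (above (x - f j)%R %% v, (i - j) + (j - i))%N; split=> //=.
  by rewrite mem_iota /= add0n ltn_pmod.
rewrite mem_iota /= add0n.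
have := ltn_pmod i u_gt0; have := ltn_pmod j u_gt0.
have := divn_eq i u; have := divn_eq j u; rewrite -equ.
move: (_ %/ u * u)%N (i %% u)%N (j %% u)%N => a b c; clear; lia.
Qed.

(** Along the representations of x the block number takes at most n/u + |B|/v + 1 values; each
    representation beyond that number is paid for by a collision. *)
Lemma sum_rep_collisions :
  (\sum_(x <- X) (rep [seq f i | i <- iota 0 n] B x - (n %/ u + size B %/ v).+1)
    <= size B * (v * u))%N.
Proof.
apply: leq_trans size_collisions.
rewrite size_filter -sum_nat_pred big_allpairs; apply: leq_sum => x _.
rewrite big_allpairs /= rep_mem // big_map leq_subLR addnC.
apply: leq_trans (@count_collisions _ _ (fun i => x - f i \in B) (block x)
  (n %/ u + size B %/ v).+1 (iota_uniq 0 n) _) _.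
  move=> i; rewrite mem_iota add0n /= => i_n xi.
  have := leq_div2r u (ltnW i_n); have := leq_div2r v (ltnW (above_size xi)).
  by rewrite /block ltnS => le_v le_u; apply: leq_add.
rewrite leq_add2r; apply: leq_sum => i _; apply: leq_sum => j _.
rewrite /collide; case: (_ \in B); case: (_ \in B); by case: eqP; case: eqP.
Qed.

End Blocks.

(** When the blocks number at most t/2 + 1, every counted x has an excess of at least t/4, while the
    total excess is at most |B| v u, of order n |B|^2 / t^2. *)
Theorem convex_incidence (t : nat) :
  (count (fun x => t <= rep [seq f i | i <- iota 0 n] B x) X * t ^ 3
    <= 100 * n * size B ^ 2)%N.
Proof.
set A := [seq f i | i <- iota 0 n]; set m := size B.
set P := fun x => _; set N := count P X.
have uA : uniq A.
  rewrite map_inj_in_uniq ?iota_uniq // => i j; rewrite !mem_iota /= !add0n => i_n jn eqf.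
  case: (ltngtP i j) => // lt_ij.
    by have := @f_mono i j; rewrite lt_ij jn eqf ltxx => /(_ isT).
  by have := @f_mono j i; rewrite lt_ij i_n eqf ltxx => /(_ isT).
have sizeA : size A = n by rewrite size_map size_iota.
have [-> //|N_gt0] := posnP N.
(* Once some x is counted, t is at most n and m; this absorbs the rounding in [u] and [v] below. *)
have [x0 _ Px0] : exists2 x, x \in X & P x by apply/hasP; rewrite has_count.
have t_n : (t <= n)%N .
  by rewrite -sizeA (leq_trans Px0) ?rep_le_size.
have t_m : (t <= m)%N .
  by rewrite (leq_trans Px0) // repC rep_le_size.
have [->|t_gt0] := posnP t; first by rewrite exp0n // muln0.
(* For t < 4 the excess could vanish; there the total number n m of representations and t^3 <= 27
   are enough. *)
have [t4|t4] := ltnP t 4.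
  have le_N : (N <= n * m)%N.
    rewrite -sizeA; apply: leq_trans (sum_rep_le A B uX).
    rewrite /N -sum_nat_pred; apply: leq_sum => x _; rewrite /P.
    by case: (boolP (t <= _)%N) => // tx; apply: leq_trans t_gt0 tx.
  have : (t ^ 3 <= 27)%N by move: t4; rewrite ltnS -(leq_exp2r _ _ (isT : 0 < 3)%N).
  have : (n * m <= n * m ^ 2)%N by rewrite leq_mul2l leq_pmulr ?orbT // (leq_trans t_gt0).
  move: (t ^ 3)%N (m ^ 2)%N => t3 m2; nia.
pose u := (4 * n %/ t).+1; pose v := (4 * m %/ t).+1.
have ut : (u * t <= 5 * n)%N.
  by rewrite mulSn; have := leq_divM (4 * n) t; lia.
have vt : (v * t <= 5 * m)%N.
  by rewrite mulSn; have := leq_divM (4 * m) t; lia.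
have un : (4 * (n %/ u) <= t)%N.
  have := ltn_ceil (4 * n) t_gt0; rewrite -/u; have := leq_divM n u; nia.
have vm : (4 * (m %/ v) <= t)%N.
  have := ltn_ceil (4 * m) t_gt0; rewrite -/v; have := leq_divM m v; nia.
have := sum_rep_collisions (ltn0Sn _ : 0 < u)%N (ltn0Sn _ : 0 < v)%N.
rewrite -/A -/m; set S := (\sum_(x <- X) _)%N => S_le.
have : (N * t <= 4 * S)%N.
  rewrite /S big_distrr /N -sum1_count big_distrl /= big_mkcond /=.
  apply: leq_sum => x _; case: ifP => // Px; move: (Px); rewrite /P mul1n; lia.
move=> le_N; apply: leq_trans (_ : (4 * m * (v * t) * (u * t) <= _)%N).
  rewrite (_ : N * t ^ 3 = N * t * (t * t))%N; last by ring.
  rewrite (_ : 4 * m * (v * t) * (u * t) = 4 * (m * (v * u)) * (t * t))%N; last by ring.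
  by rewrite leq_mul // (leq_trans le_N) // leq_mul2l S_le.
rewrite (_ : 100 * n * m ^ 2 = 4 * m * (5 * m) * (5 * n))%N; last by ring.
by do 2!apply: leq_mul => //.
Qed.

End ConvexIncidence.

(** * Differences within a finite set and their representation counts *)

Section DifferenceEnergy.
Variables (V : zmodType) (A : seq V).
Hypothesis uA : uniq A.

Let n := size A.

Definition diffs : seq V := undup [seq a - b | a <- A, b <- A].

Definition diff_rep (x : V) : nat := rep A [seq - a | a <- A] x.

Local Notation D := diffs.
Local Notation r := diff_rep.

Let shift (y t : V) : nat := (y + t)%R \in A.

Lemma uniq_opp : uniq [seq - a | a <- A].
Proof. by rewrite map_inj_uniq //; apply: oppr_inj. Qed.

Lemma diff_repE (x : V) : r x = (\sum_(a <- A) \sum_(b <- A) (a - b == x)%R)%N.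
Proof. by apply: eq_bigr => a _; rewrite big_map. Qed.

Lemma diff_rep_shift (x : V) : r x = (\sum_(b <- A) shift b x)%N.
Proof.
rewrite /diff_rep repC rep_mem // big_map; apply: eq_bigr => b _.
by rewrite /shift opprK addrC.
Qed.

Lemma diff_repN (x : V) : r (- x) = r x.
Proof.
rewrite !diff_repE exchange_big; do 2!apply: eq_bigr => ? _.
by rewrite -eqr_opp opprK opprB.
Qed.

Lemma diff_rep_le (x : V) : (r x <= n)%N.
Proof. exact: rep_le_size uniq_opp. Qed.

Lemma mem_diffs (a b : V) : a \in A -> b \in A -> a - b \in D.
Proof. by move=> Aa Ab; rewrite mem_undup; apply/allpairsP; exists (a, b). Qed.

Lemma diff_rep_gt0 (x : V) : (0 < r x)%N -> x \in D.
Proof.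
rewrite lt0n diff_repE sum_nat_seq_neq0 => /hasP[a Aa] /=.
rewrite sum_nat_seq_neq0 => /hasP[b Ab] /=; rewrite eqb0 negbK => /eqP <-.
exact: mem_diffs.
Qed.

Lemma opp_diffs (x : V) : (- x \in D) = (x \in D).
Proof.
suff key y : y \in D -> - y \in D by apply/idP/idP => /key; rewrite ?opprK.
rewrite mem_undup => /allpairsP[[a b] /= [Aa Ab ->]].
by rewrite opprB mem_diffs.
Qed.

Lemma sum_diffsN (G : V -> nat) : (\sum_(x <- D) G (- x)%R = \sum_(x <- D) G x)%N.
Proof.
rewrite -(big_map -%R xpredT G); apply: perm_big; apply: uniq_perm.
- by rewrite map_inj_uniq ?undup_uniq //; apply: oppr_inj.
- exact: undup_uniq.
by move=> x; rewrite -[x in LHS]opprK mem_map ?opp_diffs //; apply: oppr_inj.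
Qed.

Lemma sum_shift (G : V -> nat) (y : V) : y \in A ->
  (\sum_(x <- A) G (x - y)%R = \sum_(t <- D) shift y t * G t)%N.
Proof.
move=> Ay; under [RHS]eq_bigr => t _.
  rewrite /shift -(sum_fiber1 _ uA) big_distrl /=.
  over.
rewrite [RHS]exchange_big /= big_seq [RHS]big_seq; apply: eq_bigr => x Ax.
under eq_bigr => t _ do rewrite addrC eq_sym -subr_eq.
by rewrite sum_fiber ?undup_uniq // mem_diffs // mul1n.
Qed.

Lemma sum_diff (G : V -> nat) :
  (\sum_(y <- A) \sum_(x <- A) G (x - y)%R = \sum_(t <- D) r t * G t)%N.
Proof.
rewrite big_seq; under eq_bigr => y Ay do rewrite sum_shift //.
rewrite -big_seq exchange_big; apply: eq_bigr => t _.
by rewrite diff_rep_shift big_distrl.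
Qed.

(** The kernel r(x - z) is the Gram matrix of the 0-1 matrix [shift]; positive semidefiniteness is
    used in this form. *)
Lemma diff_rep_gram (x z : V) : x \in A -> z \in A ->
  (\sum_(t <- D) shift x t * shift z t = r (x - z)%R)%N.
Proof.
move=> Ax Az; under eq_bigr do rewrite mulnC.
rewrite -(sum_shift (shift x) Az) diff_rep_shift; apply: eq_bigr => b _.
by rewrite /shift addrCA addrA.
Qed.

(** * Restriction to differences with few representations *)

Definition energy : nat := (\sum_(x <- D) r x ^ 2)%N.
Definition energy3 : nat := (\sum_(x <- D) r x ^ 3)%N.

Local Notation E := energy.
Local Notation E3 := energy3.

(** The condition r(x) <= 2 E3 / E without division. *)
Let low (x : V) : bool := (r x * E <= 2 * E3)%N.
Let r1 (x : V) : nat := (r x * low x)%N.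

Let Q : nat := (\sum_(y <- A) \sum_(x <- A) \sum_(z <- A)
  r1 (x - y)%R * r1 (z - y)%R * r (x - z)%R)%N.

Let E1 : nat := (\sum_(x <- D) r x * r1 x)%N.

(** Outside [low] one has 2 E3 r^2 <= E r^3, so that part carries at most E/2. If E3 = 0 then E = 0,
    because r^2 <= r^3 for natural numbers. *)
Lemma energy_le_low : (E <= 2 * E1)%N.
Proof.
have [E3_0|E3_gt0] := posnP E3.
  have : (E <= E3)%N.
    by apply: leq_sum => x _; case: (r x) => // k; apply: leq_pexp2l.
  by rewrite E3_0; lia.
have split_low : E = (E1 + \sum_(x <- D) r x ^ 2 * ~~ low x)%N.
  rewrite /E /E1 -big_split; apply: eq_bigr => x _ /=.
  by rewrite /r1; case: low; rewrite ?muln1 ?muln0 ?addn0 // mulnn.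
set S := (\sum_(x <- D) r x ^ 2 * ~~ low x)%N in split_low.
have : (2 * E3 * S <= E3 * E)%N.
  rewrite /S big_distrr [in X in (_ <= X)%N]/energy3 big_distrl; apply: leq_sum => x _.
  rewrite /low /=; case: (leqP (r x * E) (2 * E3)) => h /=; first by rewrite !muln0.
  rewrite muln1 (_ : r x ^ 3 * E = r x ^ 2 * (r x * E))%N; last by ring.
  by rewrite mulnC leq_mul2l ltnW ?orbT.
rewrite -mulnA mulnCA leq_mul2l; lia.
Qed.

(** With M the matrix [shift], T = M M^t and T' the kernel of [r1], the vectors are b = T' 1, c =
    M^t b, d = M^t 1. Then E1^2 <= n |b|^2; |b|^2 <= <c, d> because T' <= T entrywise; |d|^2 = E;
    and |c|^2 <= n Q by Cauchy-Schwarz over y. *)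
Lemma low_le_form : (E1 ^ 4 <= n ^ 3 * E * Q)%N.
Proof.
pose b x := (\sum_(y <- A) r1 (x - y)%R)%N.
pose c t := (\sum_(x <- A) shift x t * b x)%N.
pose d t := (\sum_(x <- A) shift x t)%N.
have sum_b : (\sum_(x <- A) b x = E1)%N by rewrite /b exchange_big sum_diff.
have QE : Q = (\sum_(y <- A) \sum_(t <- D) (\sum_(x <- A) shift x t * r1 (x - y)%R) ^ 2)%N.
  apply: eq_bigr => y _; under [RHS]eq_bigr => t _.
    rewrite expnS expn1 big_distrlr /=.
    over.
  rewrite [RHS]exchange_big /= big_seq [RHS]big_seq; apply: eq_bigr => x Ax.
  rewrite [RHS]exchange_big /= big_seq [RHS]big_seq; apply: eq_bigr => z Az.
  by rewrite -diff_rep_gram // big_distrr; apply: eq_bigr => t _ /=; ring.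
have c_le_Q : (\sum_(t <- D) c t ^ 2 <= n * Q)%N.
  rewrite QE exchange_big big_distrr; apply: leq_sum => t _ /=.
  rewrite (_ : c t = \sum_(y <- A) \sum_(x <- A) shift x t * r1 (x - y)%R)%N.
    exact: sum_nat_Cauchy1.
  by rewrite /c /b exchange_big; apply: eq_bigr => x _; rewrite big_distrr.
have sum_d2 : (\sum_(t <- D) d t ^ 2 = E)%N.
  by apply: eq_bigr => t _; rewrite diff_rep_shift.
have b_le_cd : (\sum_(x <- A) b x ^ 2 <= \sum_(t <- D) c t * d t)%N.
  under [X in (_ <= X)%N]eq_bigr => t _ do rewrite /c big_distrl.
  rewrite exchange_big; apply: leq_sum_seq => x Ax /=.
  under eq_bigr => t _ do rewrite -mulnA mulnCA.
  rewrite -big_distrr expnS expn1 leq_mul2l; apply/orP; right.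
  under eq_bigr => t _ do rewrite big_distrr.
  rewrite exchange_big; apply: leq_sum_seq => y Ay /=.
  by rewrite diff_rep_gram // /r1 -[X in (_ <= X)%N]muln1 leq_mul2l leq_b1 orbT.
have := sum_nat_Cauchy1 A b; rewrite sum_b => E1_le.
have := sum_nat_Cauchy D c d; rewrite sum_d2 => cd_le.
apply: leq_trans (_ : (n * (n * ((n * Q) * E)) <= _)%N); last by apply/eq_leq; ring.
apply: leq_trans (_ : (n * (n * (\sum_(t <- D) c t * d t) ^ 2) <= _)%N).
  rewrite (_ : E1 ^ 4 = (E1 ^ 2) ^ 2)%N; last by rewrite -expnM.
  rewrite mulnA mulnn -expnMn leq_sqr (leq_trans E1_le) // leq_mul2l b_le_cd.
  by rewrite orbT.
by rewrite !leq_mul2l (leq_trans cd_le) ?orbT // leq_mul2r c_le_Q orbT.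
Qed.

Let X : nat := (\sum_(a <- D) \sum_(b <- D) (r1 a * r1 b * r (a - b)%R) ^ 2)%N.

(** Cauchy-Schwarz over pairs (a, b) separates the weights from the number [C a b] of y in A with y
    + a and y + b in A. *)
Lemma form_le : (Q ^ 2 <= E3 * X)%N.
Proof.
pose C a b := (\sum_(y <- A) shift y a * shift y b)%N.
have QE : Q = (\sum_(a <- D) \sum_(b <- D) C a b * (r1 a * r1 b * r (a - b)%R))%N.
  transitivity (\sum_(y <- A) \sum_(a <- D) \sum_(b <- D)
    shift y a * shift y b * (r1 a * r1 b * r (a - b)%R))%N.
    rewrite /Q big_seq [RHS]big_seq; apply: eq_bigr => y Ay.
    pose G a := (\sum_(z <- A) r1 a * r1 (z - y)%R * r (a - (z - y))%R)%N.
    transitivity (\sum_(x <- A) G (x - y)%R)%N.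
      apply: eq_bigr => x _; apply: eq_bigr => z _; congr (_ * r _)%N.
      by rewrite opprB addrA subrK.
    rewrite (sum_shift G Ay); apply: eq_bigr => a _.
    rewrite /G (sum_shift (fun c => r1 a * r1 c * r (a - c)%R)%N Ay) big_distrr.
    by apply: eq_bigr => c _ /=; rewrite mulnA.
  rewrite exchange_big; apply: eq_bigr => a _; rewrite exchange_big.
  by apply: eq_bigr => b _; rewrite /C big_distrl.
(* The square of [C] runs over pairs y, z in A; the sums over a and b then factor, each giving r(z -
   y). *)
have C2 : (\sum_(a <- D) \sum_(b <- D) C a b ^ 2 = E3)%N.
  transitivity (\sum_(y <- A) \sum_(z <- A) r (z - y)%R ^ 2)%N; last first.
    by rewrite (sum_diff (fun x => r x ^ 2)%N); apply: eq_bigr => x _; rewrite -expnS.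
  transitivity (\sum_(y <- A) \sum_(z <- A) \sum_(a <- D) \sum_(b <- D)
    (shift z a * shift y a) * (shift z b * shift y b))%N; last first.
    rewrite big_seq [RHS]big_seq; apply: eq_bigr => y Ay.
    rewrite big_seq [RHS]big_seq; apply: eq_bigr => z Az.
    by rewrite -diff_rep_gram // expnS expn1 big_distrlr.
  transitivity (\sum_(a <- D) \sum_(b <- D) \sum_(y <- A) \sum_(z <- A)
    (shift z a * shift y a) * (shift z b * shift y b))%N.
    do 2!apply: eq_bigr => ? _; rewrite /C expnS expn1 big_distrlr /=.
    by do 2!apply: eq_bigr => ? _; ring.
  under eq_bigr => a _ do rewrite exchange_big.
  rewrite exchange_big; apply: eq_bigr => y _ /=.
  under eq_bigr => a _ do rewrite exchange_big.
  by rewrite exchange_big.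
have := sum_nat_Cauchy [seq (a, b) | a <- D, b <- D] (fun p => C p.1 p.2)
  (fun p => r1 p.1 * r1 p.2 * r (p.1 - p.2)%R)%N.
by rewrite !big_allpairs /= -QE C2.
Qed.

(** * Zero-sum triples ordered by representation count *)

Let zero_sum (F : V -> V -> V -> nat) : nat :=
  (\sum_(a <- D) \sum_(b <- D) \sum_(c <- D) (a + b + c == 0)%R * F a b c)%N.

Let low_min (a b c : V) : nat :=
  ((r a * r b * r c) ^ 2 * [&& low a, r a <= r b & r a <= r c])%N.

Let Y : nat := zero_sum low_min.

Lemma low_pairs_le : (X <= 3 * Y)%N.
Proof.
pose W a b c := ((r1 a * r1 b * r c) ^ 2)%N.
have lowN x : low (- x) = low x by rewrite /low diff_repN.
(* Replacing b by -b turns a - b into a + b = -c. Both r and [low] are even, and r(a + b) = 0 when a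
   + b is outside [D]. *)
have -> : X = zero_sum W.
  apply: eq_bigr => a _; rewrite -sum_diffsN; apply: eq_bigr => b _.
  transitivity (\sum_(c <- D) (- (a + b) == c)%R * W a b c)%N; last first.
    by apply: eq_bigr => c _; rewrite -subr_eq0 -opprD oppr_eq0.
  rewrite sum_fiber ?undup_uniq // /W /r1 opprK diff_repN lowN diff_repN opp_diffs.
  have [|/negP h] := boolP (a + b \in D); first by rewrite mul1n.
  have [->|/diff_rep_gt0] := posnP (r (a + b)); last by [].
  by rewrite muln0.
(* If c has the smallest r, it inherits [low] from a; so whichever of the three is least supplies a
   term. *)
have W_le a b c : (W a b c <= low_min a b c + low_min b a c + low_min c a b)%N.
  have -> : low_min b a c = ((r a * r b * r c) ^ 2 * [&& low b, r b <= r a & r b <= r c])%N.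
    by rewrite /low_min (mulnC (r b)).
  have -> : low_min c a b = ((r a * r b * r c) ^ 2 * [&& low c, r c <= r a & r c <= r b])%N.
    by rewrite /low_min (_ : r c * r a * r b = r a * r b * r c)%N //; ring.
  rewrite -!mulnDr /W /r1.
  have [low_a|_] := boolP (low a); last by rewrite muln0 !mul0n.
  have [low_b|_] := boolP (low b); last by rewrite muln0 muln0 mul0n.
  rewrite !muln1 leq_pmulr //= lt0n !addn_eq0 !eqb0 -!negb_or negbK.
  have low_c : (r c <= r a)%N -> low c.
    by move=> le_ca; apply: leq_trans low_a; rewrite leq_mul2r le_ca orbT.
  have [ca|ac] := leqP (r c) (r a).
    have [cb|bc] := leqP (r c) (r b); first by rewrite (low_c ca) !orbT.
    by rewrite (ltnW bc) (leq_trans (ltnW bc) ca) orbT.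
  have [ab|ba] := leqP (r a) (r b); first by rewrite (ltnW ac).
  by rewrite (ltnW ba) (ltnW (ltn_trans ba ac)).
have swap12 F : zero_sum (fun a b c => F b a c) = zero_sum F.
  rewrite /zero_sum exchange_big; apply: eq_bigr => a _; apply: eq_bigr => b _ /=.
  by apply: eq_bigr => c _; rewrite (addrC a).
have swap23 F : zero_sum (fun a b c => F a c b) = zero_sum F.
  apply: eq_bigr => a _; rewrite exchange_big; do 2!apply: eq_bigr => ? _ /=.
  by rewrite addrAC.
have -> : (3 * Y = zero_sum (fun a b c => low_min a b c + low_min b a c + low_min c a b))%N.
  transitivity (zero_sum low_min + zero_sum (fun a b c => low_min b a c)
    + zero_sum (fun a b c => low_min c a b))%N.
    rewrite (swap23 (fun a b c => low_min b a c)) (swap12 low_min) -/Y.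
    by rewrite !mulSn mul0n addn0 addnA.
  rewrite /zero_sum -!big_split; apply: eq_bigr => a _ /=.
  rewrite -!big_split; apply: eq_bigr => b _ /=.
  by rewrite -!big_split; apply: eq_bigr => c _ /=; rewrite !mulnDr.
by do 3!apply: leq_sum => ? _; rewrite leq_mul2l W_le orbT.
Qed.

(** * Consequences of the incidence bound on dyadic levels *)

Variable K : nat.
Hypothesis incidence : forall (B S : seq V) (t : nat), uniq B -> uniq S ->
  (count (fun x => t <= rep A B x) S * t ^ 3 <= K * n * size B ^ 2)%N.

(** Since r <= n < 2^J, the scales 2^0, ..., 2^(J-1) cover all positive values of r. *)
Let J := (trunc_log 2 n).+1.

(** Cubes match the exponent of [incidence]: each of the J thresholds 2^j contributes the same
    amount. The 8 pays for rounding up to the next power of 2. *)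
Lemma sum_rep_cube (B S : seq V) : uniq B -> uniq S ->
  (\sum_(x <- S) rep A B x ^ 3 <= 8 * J * K * n * size B ^ 2)%N.
Proof.
move=> uB uS.
apply: leq_trans (_ : \sum_(x <- S) \sum_(j <- iota 0 J)
    (2 ^ j <= rep A B x) * 8 ^ j.+1 <= _)%N.
  apply: leq_sum => x _; have [->|rep_gt0] := posnP (rep A B x); first by rewrite exp0n.
  apply: leq_trans (@expn_le_dyadic 3 0 J _ _) _.
    by rewrite rep_gt0 (leq_ltn_trans (rep_le_size _ _ uB)) ?trunc_log_ltn.
  by apply: leq_sum => j _; rewrite mul1n.
rewrite exchange_big /=.
apply: leq_trans (_ : \sum_(j <- iota 0 J) 8 * (K * n * size B ^ 2) <= _)%N.
  apply: leq_sum => j _; rewrite -big_distrl sum_nat_pred /= expnS mulnCA leq_mul2l /=.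
  by rewrite (_ : 8 ^ j = (2 ^ j) ^ 3)%N ?incidence // -!expnM mulnC expnM.
by rewrite big_const_seq count_predT size_iota iter_addn_0; apply/eq_leq; ring.
Qed.

Lemma energy3_le : (E3 <= 8 * J * K * n ^ 3)%N.
Proof.
apply: leq_trans (sum_rep_cube uniq_opp (undup_uniq _)) _.
by rewrite size_map -/n; apply/eq_leq; ring.
Qed.

Let level (j : nat) : seq V := [seq x <- D | (2 ^ j <= r x)%N].

Let uniq_level (j : nat) : uniq (level j).
Proof. by rewrite filter_uniq ?undup_uniq. Qed.

Lemma size_level (j : nat) : (size (level j) * 8 ^ j <= K * n ^ 3)%N.
Proof.
have := incidence (2 ^ j) uniq_opp (undup_uniq [seq a - b | a <- A, b <- A]).
rewrite size_map size_filter -/n (_ : (2 ^ j) ^ 3 = 8 ^ j)%N -?mulnA -?expnS //.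
by rewrite -expnM mulnC expnM.
Qed.

Let sums : seq V := undup [seq a + b | a <- A, b <- D].

Let level_energy (j : nat) : nat := (\sum_(x <- sums) rep A (level j) x ^ 2)%N.

(** The second moment is interpolated between the first, at most n |level|, and the third, bounded
    by [sum_rep_cube]. *)
Let level_energy_le (j : nat) :
  (level_energy j ^ 2 <= 8 * J * K * n ^ 2 * size (level j) ^ 3)%N.
Proof.
have uS : uniq sums := undup_uniq _.
have Cauchy : (level_energy j ^ 2 <= (\sum_(x <- sums) rep A (level j) x) *
    (\sum_(x <- sums) rep A (level j) x ^ 3))%N.
  by apply: sum_nat_Cauchy_le => x; rewrite -expnM -expnS.
apply: leq_trans Cauchy _.
apply: leq_trans (leq_mul (sum_rep_le _ _ uS) (sum_rep_cube (uniq_level j) uS)) _.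
by apply/eq_leq; rewrite -/n; ring.
Qed.

Let big_rep (i : nat) (b : V) : nat := (r b ^ 2 * (2 ^ i <= r b))%N.

Let pair_sum (i : nat) : nat :=
  zero_sum (fun a b c => r a * big_rep i b * big_rep i c)%N.

Let diff_rep_lt (x : V) : (r x < 2 ^ J)%N.
Proof. by rewrite (leq_ltn_trans (diff_rep_le x)) ?trunc_log_ltn. Qed.

(** Here i is the dyadic scale of r(a), the smallest of the three: one factor r(a) is bounded by
    2^(i+1), the other is kept for expansion into pairs of A. *)
Let low_triples_le : (Y <= \sum_(i <- iota 0 J)
  (2 ^ i * E <= 2 * E3) * 2 ^ i.+1 * pair_sum i)%N.
Proof.
have pointwise a b c : (low_min a b c <= \sum_(i <- iota 0 J)
    (2 ^ i * E <= 2 * E3) * 2 ^ i.+1 * (r a * big_rep i b * big_rep i c))%N.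
  rewrite /low_min; case: and3P => [[low_a ab ac]|_]; last by rewrite muln0.
  have [->|ra_gt0] := posnP (r a); first by rewrite !mul0n.
  have /andP[le_i lt_i] := trunc_log_bounds (isT : 1 < 2)%N ra_gt0.
  set i := trunc_log 2 (r a) in le_i lt_i.
  have iJ : i \in iota 0 J by rewrite mem_iota /= add0n ltnS leq_trunc_log ?diff_rep_le.
  apply: leq_trans (leq_sum_term _ iJ).
  rewrite /big_rep (leq_trans le_i ab) (leq_trans le_i ac) !muln1.
  rewrite (_ : (2 ^ i * E <= 2 * E3)%N); last first.
    by apply: leq_trans low_a; rewrite leq_mul2r le_i orbT.
  rewrite mul1n (_ : (r a * r b * r c) ^ 2 = r a * (r a * r b ^ 2 * r c ^ 2))%N; last by ring.
  by rewrite leq_mul2r ltnW ?orbT.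
rewrite /Y /pair_sum /zero_sum.
under [X in (_ <= X)%N]eq_bigr => i _ do rewrite big_distrr.
rewrite [X in (_ <= X)%N]exchange_big; apply: leq_sum => a _ /=.
under [X in (_ <= X)%N]eq_bigr => i _ do rewrite big_distrr.
rewrite [X in (_ <= X)%N]exchange_big; apply: leq_sum => b _ /=.
under [X in (_ <= X)%N]eq_bigr => i _ do rewrite big_distrr.
rewrite [X in (_ <= X)%N]exchange_big; apply: leq_sum => c _ /=.
under [X in (_ <= X)%N]eq_bigr => i _ do rewrite mulnCA.
by rewrite -big_distrr leq_mul2l pointwise orbT.
Qed.

(** Expanding r(b - c) into pairs of A makes [pair_sum] the sum of the squares of [F], the
    convolution of A with [w]. Splitting [w] into levels and Cauchy-Schwarz over the J levels leave
    energies between A and single levels. *)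
Let pair_sum_le (i : nat) : (pair_sum i <= J * \sum_(j <- iota 0 J)
  (i <= j) * 16 ^ j.+1 * level_energy j)%N.
Proof.
pose w := big_rep i.
have wN b : big_rep i (- b) = w b by rewrite /w /big_rep diff_repN.
pose F (x : V) := (\sum_(p <- [seq (a, b) | a <- A, b <- D]) w p.2 * (p.1 + p.2 == x)%R)%N.
have -> : pair_sum i = (\sum_(x <- sums) F x ^ 2)%N.
  have <- := @sum_fiber_sq _ V [seq (a, b) | a <- A, b <- D] sums (fun p => w p.2)
    (fun p => p.1 + p.2) (undup_uniq _); last first.
    move=> p /allpairsP[[a b] /= [Aa Db ->]] _.
    by rewrite mem_undup; apply/allpairsP; exists (a, b).
  transitivity (\sum_(b <- D) \sum_(c <- D) r (b - c)%R * (w b * w c))%N.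
    rewrite /pair_sum /zero_sum exchange_big; apply: eq_bigr => b _ /=.
    rewrite exchange_big -[LHS]sum_diffsN; apply: eq_bigr => c _ /=.
    transitivity (\sum_(a <- D) ((c - b)%R == a) * (r a * (w b * w c)))%N.
      by apply: eq_bigr => a _; rewrite -mulnA wN subr_eq0 [in RHS]subr_eq eq_sym.
    rewrite sum_fiber ?undup_uniq // -[r (b - c)]diff_repN opprB.
    have [_|] := boolP (c - b \in D); first by rewrite mul1n.
    by have [->|/diff_rep_gt0 ->] := posnP (r (c - b)).
  rewrite big_allpairs [RHS]exchange_big.
  under [RHS]eq_bigr => b _ do under eq_bigr => a _ do rewrite big_allpairs exchange_big /=.
  apply: eq_bigr => b _; rewrite [RHS]exchange_big /=; apply: eq_bigr => c _.
  rewrite diff_repE exchange_big big_distrl; apply: eq_bigr => a _ /=.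
  rewrite big_distrl; apply: eq_bigr => a' _ /=; rewrite mulnC; congr (_ * nat_of_bool _)%N.
  by rewrite subr_eq addrAC eq_sym subr_eq addrC.
have F_le x : (F x <= \sum_(j <- iota 0 J) (i <= j) * 4 ^ j.+1 * rep A (level j) x)%N.
  have w_le b : (w b <= \sum_(j <- iota 0 J) (i <= j) * (2 ^ j <= r b) * 4 ^ j.+1)%N.
    rewrite /w /big_rep; have [le_i|_] := boolP (2 ^ i <= r b)%N; last by rewrite muln0.
    by rewrite muln1 (@expn_le_dyadic 2) // le_i diff_rep_lt.
  apply: leq_trans (_ : \sum_(p <- [seq (a, b) | a <- A, b <- D])
    \sum_(j <- iota 0 J) (i <= j) * (2 ^ j <= r p.2) * 4 ^ j.+1 * (p.1 + p.2 == x)%R <= _)%N.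
    by apply: leq_sum => p _; rewrite -big_distrl leq_mul2r w_le orbT.
  rewrite exchange_big; apply: leq_sum => j _ /=.
  rewrite big_allpairs /rep big_distrr; apply: leq_sum => a _ /=.
  rewrite big_filter [in X in (_ <= X)%N]big_mkcond big_distrr; apply: leq_sum => b _ /=.
  by case: ifP => _; rewrite ?muln0 ?mul0n ?muln1.
apply: leq_trans (_ : \sum_(x <- sums) J * \sum_(j <- iota 0 J)
  ((i <= j) * 4 ^ j.+1 * rep A (level j) x) ^ 2 <= _)%N.
  apply: leq_sum => x _; pose G j := ((i <= j) * 4 ^ j.+1 * rep A (level j) x)%N.
  apply: leq_trans (_ : (\sum_(j <- iota 0 J) G j) ^ 2 <= _)%N; first by rewrite leq_sqr.
  by have := sum_nat_Cauchy1 (iota 0 J) G; rewrite size_iota.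
rewrite -big_distrr leq_mul2l exchange_big; apply/orP; right; apply: leq_sum => j _ /=.
rewrite /level_energy big_distrr; apply: leq_sum => x _; apply/eq_leq.
by rewrite !expnMn (_ : 16 = 4 ^ 2)%N // -!expnM (mulnC 2) /=; case: (i <= j)%N.
Qed.

Let dyadic_term (i j : nat) : nat :=
  ((i <= j) * (2 ^ i * E <= 2 * E3) * 2 ^ i * 16 ^ j * level_energy j)%N.

Let dyadic_term_le (i j : nat) :
  (E * dyadic_term i j ^ 2 <= 16 * J * K ^ 4 * n ^ 11 * E3)%N.
Proof.
rewrite /dyadic_term.
have [le_ij|_] := boolP (i <= j)%N; last by rewrite muln0.
have [low_i|_] := boolP (2 ^ i * E <= 2 * E3)%N; last by rewrite muln0.
(* The extra 2^j turns 16^(2j) into (8^j)^3, matching the cube of [size_level]. Of the two factors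
   2^i, one is absorbed by 2^i E <= 2 E3, the other is at most 2^j and cancels the extra factor. *)
rewrite !mul1n -(leq_pmul2l (_ : 0 < 2 ^ j)%N) ?expn_gt0 //.
pose s := size (level j).
have sq16 : (2 ^ j * (16 ^ j) ^ 2 = (8 ^ j) ^ 3)%N.
  by rewrite -!expnM !(mulnC j) !expnM -expnMn.
apply: leq_trans (_ :
  2 ^ j * (E * ((2 ^ i) ^ 2 * (16 ^ j) ^ 2 * (8 * J * K * n ^ 2 * s ^ 3))) <= _)%N.
  by rewrite !expnMn !leq_mul2l level_energy_le !orbT.
rewrite (_ : 2 ^ j * _ = (2 ^ i * E) * 2 ^ i * (8 * J * K * n ^ 2 * (s * 8 ^ j) ^ 3))%N; last first.
  by rewrite expnMn -sq16; ring.
apply: leq_trans (_ : (2 * E3) * 2 ^ j * (8 * J * K * n ^ 2 * (K * n ^ 3) ^ 3) <= _)%N.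
  apply: leq_mul; first by rewrite leq_mul // leq_exp2l.
  by rewrite leq_mul2l leq_exp2r // size_level orbT.
by apply/eq_leq; ring.
Qed.

Let low_triples_energy_le : (E * Y ^ 2 <= 2 ^ 14 * J ^ 7 * K ^ 4 * n ^ 11 * E3)%N.
Proof.
pose S := (\sum_(i <- iota 0 J) \sum_(j <- iota 0 J) dyadic_term i j)%N.
have Y_le : (Y <= 32 * J * S)%N.
  apply: leq_trans low_triples_le _; rewrite /S [X in (_ <= X)%N]big_distrr.
  apply: leq_sum => i _ /=.
  apply: leq_trans (leq_mul (leqnn _) (pair_sum_le i)) _.
  rewrite /dyadic_term; set l := nat_of_bool (_ <= 2 * E3)%N.
  rewrite !big_distrr; apply: leq_sum => j _ /=; apply/eq_leq.
  by rewrite !expnS; ring.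
have S_le : (E * S ^ 2 <= J ^ 4 * (16 * J * K ^ 4 * n ^ 11 * E3))%N.
  apply: leq_trans (_ :
    E * (J * \sum_(i <- iota 0 J) J * \sum_(j <- iota 0 J) dyadic_term i j ^ 2) <= _)%N.
    rewrite leq_mul2l; apply/orP; right.
    have := sum_nat_Cauchy1 (iota 0 J) (fun i => \sum_(j <- iota 0 J) dyadic_term i j)%N.
    rewrite size_iota => /leq_trans; apply; rewrite leq_mul2l; apply/orP; right.
    apply: leq_sum => i _.
    by have := sum_nat_Cauchy1 (iota 0 J) (dyadic_term i); rewrite size_iota.
  move: (fun i j => dyadic_term_le i j); move: (16 * J * K ^ 4 * n ^ 11 * E3)%N E => c e term_le.
  rewrite (_ : J ^ 4 * c = J * (J * (J * (J * c))))%N; last by ring.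
  rewrite mulnCA leq_mul2l; apply/orP; right.
  rewrite -[X in (_ <= X * _)%N](size_iota 0 J) big_distrr; apply: sum_nat_le_const => i /=.
  rewrite mulnCA leq_mul2l; apply/orP; right.
  rewrite -[X in (_ <= X * _)%N](size_iota 0 J) big_distrr; apply: sum_nat_le_const => j /=.
  exact: term_le.
apply: leq_trans (_ : (32 * J) ^ 2 * (E * S ^ 2) <= _)%N.
  by rewrite mulnCA leq_mul2l -expnMn leq_sqr Y_le orbT.
apply: leq_trans (leq_mul (leqnn _) S_le) _.
rewrite expnMn (_ : 16 = 2 ^ 4)%N // (_ : 32 ^ 2 = 2 ^ 10)%N; last first.
  by rewrite (_ : 32 = 2 ^ 5)%N // -expnM.
rewrite (_ : 2 ^ 14 = 2 ^ 10 * 2 ^ 4)%N; last by rewrite -expnD.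
by move: (2 ^ 10)%N (2 ^ 4)%N => c d; apply/eq_leq; ring.
Qed.

(** E^12 is bounded through Q^4 by E3^2 Y^2; one more E is spent on E Y^2, which leaves E3^3. The
    powers of n add up to 12 + 11 + 9, those of J to 7 + 3. *)
Theorem energy_pow13_le : (E ^ 13 <= 2 ^ 43 * K ^ 7 * J ^ 10 * n ^ 32)%N.
Proof.
have [->|E_gt0] := posnP E; first by rewrite exp0n.
have cube_le : (E ^ 3 <= 2 ^ 4 * n ^ 3 * Q)%N.
  rewrite -(leq_pmul2l E_gt0) -expnS.
  apply: leq_trans (_ : (2 * E1) ^ 4 <= _)%N; first by rewrite leq_exp2r // energy_le_low.
  rewrite expnMn; apply: leq_trans (leq_mul (leqnn _) low_le_form) _.
  by move: (2 ^ 4)%N => c; apply/eq_leq; ring.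
have pow12_le : (E ^ 12 <= 2 ^ 16 * n ^ 12 * (E3 ^ 2 * (3 * Y) ^ 2))%N.
  rewrite (_ : E ^ 12 = ((E ^ 3) ^ 2) ^ 2)%N; last by rewrite -!expnM.
  apply: leq_trans (_ : ((2 ^ 4 * n ^ 3 * Q) ^ 2) ^ 2 <= _)%N; first by rewrite !leq_exp2r.
  rewrite (_ : ((2 ^ 4 * n ^ 3 * Q) ^ 2) ^ 2 = 2 ^ 16 * n ^ 12 * (Q ^ 2) ^ 2)%N; last first.
    by rewrite (expnM 2 4 4); move: (2 ^ 4)%N => c; ring.
  rewrite leq_mul2l -expnMn leq_sqr (leq_trans form_le) ?orbT //.
  by rewrite leq_mul2l low_pairs_le orbT.
rewrite expnS; apply: leq_trans (leq_mul (leqnn _) pow12_le) _.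
rewrite (_ : E * _ = 2 ^ 16 * n ^ 12 * E3 ^ 2 * 9 * (E * Y ^ 2))%N; last first.
  by move: (2 ^ 16)%N => c; ring.
apply: leq_trans (leq_mul (leqnn _) low_triples_energy_le) _.
pose c := (2 ^ 14 * J ^ 7 * K ^ 4 * n ^ 11)%N.
apply: leq_trans (_ : 2 ^ 16 * n ^ 12 * 2 ^ 4 * c * E3 ^ 3 <= _)%N.
  rewrite (_ : 2 ^ 16 * n ^ 12 * E3 ^ 2 * 9 * _ =
    2 ^ 16 * n ^ 12 * 9 * c * E3 ^ 3)%N /c; last first.
    by move: (2 ^ 16)%N (2 ^ 14)%N => d e; ring.
  by rewrite !leq_mul.
apply: leq_trans (_ : 2 ^ 16 * n ^ 12 * 2 ^ 4 * c * (2 ^ 3 * J * K * n ^ 3) ^ 3 <= _)%N.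
  by rewrite leq_mul2l leq_exp2r // energy3_le orbT.
rewrite (_ : 43 = 16 + 4 + 14 + 3 * 3)%N // !expnD (expnM 2).
by rewrite /c; move: (2 ^ 16)%N (2 ^ 4)%N (2 ^ 14)%N (2 ^ 3)%N => d e g h; apply/eq_leq; ring.
Qed.

End DifferenceEnergy.

(** * Passage to finite sets of reals and real exponents *)

Lemma perm_fsetM (K K' : choiceType) (X : {fset K}) (Y : {fset K'})
    (s : seq K) (t : seq K') :
  uniq s -> uniq t -> s =i X -> t =i Y ->
  perm_eq (X `*` Y) [seq (a, b) | a <- s, b <- t].
Proof.
move=> us ut sX tY; apply: uniq_perm; first exact: fset_uniq.
  by apply: allpairs_uniq => // -[? ?] [? ?].
move=> [a b]; rewrite -[LHS]/((a, b) \in X `*` Y) in_fsetM -sX -tY /=.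
apply/andP/allpairsP => [[sa tb]|[[a' b'] /= [sa tb [-> ->]]]]; last by [].
by exists (a, b).
Qed.

(** With one pair of the quadruple fixed, r at its difference counts the other; sorting the fixed
    pairs by difference gives the second factor r. *)
Lemma additive_energyE (R : realType) (A : {fset R}) (s : seq R) :
  uniq s -> s =i A -> additive_energy A = energy s.
Proof.
move=> us sA; have perm_sA := perm_fsetM us us sA sA.
rewrite /additive_energy card_fset_sum1 -big_fset_condE big_mkcond /=.
rewrite (perm_big _ (perm_fsetM (fset_uniq _) (fset_uniq _) (fun=> erefl) (fun=> erefl))).
rewrite big_allpairs /= (perm_big _ perm_sA) /=.
transitivity (\sum_(p <- [seq (a, b) | a <- s, b <- s]) diff_rep s (p.1 - p.2))%N.
  apply: eq_bigr => p _; rewrite (perm_big _ perm_sA) big_allpairs diff_repE /=.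
  by do 2!apply: eq_bigr => ? _; rewrite eq_sym; case: eqP.
rewrite big_allpairs exchange_big /= (sum_diff us (diff_rep s)).
by apply: eq_bigr => x _; rewrite expnS expn1.
Qed.

Theorem theorem1 (R : realType) :
  exists C : R, 0 < C /\
    forall A : {fset R}, convex_fset A -> (2 <= #|` A|)%N ->
      (additive_energy A)%:R <=
        C * (#|` A|%:R `^ (32 / 13)) * (log2 #|` A|%:R) `^ (71 / 65).
Proof.
(* After raising to the power 13 the constant must dominate 2^43 * 100^7 * 2^10, with 2^10 from J <=
   2 L; as 100 <= 2^7 this is at most 2^102, below 2^104. *)
exists (2 ^+ 8); split; first by rewrite exprn_gt0.
move=> A A_convex A_ge2; set n := #|` A|.
pose s := sort <=%R (enum_fset A).
have us : uniq s by rewrite sort_uniq fset_uniq.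
have sA : s =i A by move=> x; rewrite mem_sort.
have size_s : size s = n by rewrite size_sort.
have sE : [seq fset_elt A i | i <- iota 0 n] = s.
  by rewrite -size_s; apply: mkseq_nth.
have f_mono i j : (i < j < n)%N -> fset_elt A i < fset_elt A j.
  move=> /andP[lt_ij jn]; have s_sorted : sorted <%O s by rewrite sort_lt_sorted fset_uniq.
  by rewrite (lt_sorted_ltn_nth _ s_sorted) ?inE ?size_sort // (ltn_trans lt_ij).
have f_convex i : (i.+2 < n)%N ->
    fset_elt A i.+1 - fset_elt A i < fset_elt A i.+2 - fset_elt A i.+1.
  exact: A_convex.
have incidence (B S : seq R) (t : nat) : uniq B -> uniq S ->
    (count (fun x => t <= rep s B x) S * t ^ 3 <= 100 * size s * size B ^ 2)%N.
  by move=> uB uS; have := convex_incidence f_mono f_convex uB uS t; rewrite sE size_s.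
set L := log2 n%:R.
have n_gt0 : 0 < n%:R :> R by rewrite ltr0n (leq_trans _ A_ge2).
have ln2_gt0 : 0 < ln 2 :> R by rewrite ln_gt0 // ltr1n.
have log_le : (trunc_log 2 n)%:R <= L.
  rewrite ler_pdivlMr // -ln_powR.
  rewrite ler_ln ?posrE ?powR_gt0 // powR_mulrn // -natrX ler_nat.
  by rewrite trunc_logP // (leq_trans _ A_ge2).
have L_ge1 : 1 <= L.
  by rewrite (le_trans _ log_le) // ler1n trunc_log_gt0.
have J_le : (trunc_log 2 n).+1%:R <= 2 * L by rewrite -natr1; lra.
have L_ge0 : 0 <= L by apply: le_trans L_ge1.
have T_ge0 : 0 <= 2 ^+ 8 * (n%:R `^ (32 / 13)) * L `^ (71 / 65) :> R.
  by rewrite !mulr_ge0 ?exprn_ge0 ?powR_ge0.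
suff : (additive_energy A)%:R ^+ 13 <= (2 ^+ 8 * (n%:R `^ (32 / 13)) * L `^ (71 / 65)) ^+ 13.
  by rewrite (@ler_pXn2r R 13 isT) ?nnegrE ?ler0n.
rewrite 2!exprMn.
have -> : (n%:R `^ (32 / 13)) ^+ 13 = n%:R ^+ 32 :> R.
  rewrite -powR_mulrn ?powR_ge0 // -powRrM -powR_mulrn ?ler0n //; congr (_ `^ _).
  by rewrite divfK // pnatr_eq0.
(* Here 13 * 71/65 = 71/5 exceeds 10, and L >= 1. *)
have L_le : L ^+ 10 <= (L `^ (71 / 65)) ^+ 13.
  rewrite -powR_mulrn // -powR_mulrn ?powR_ge0 // -powRrM ler_powR //.
  lra.
have E_le : (additive_energy A)%:R ^+ 13 <=
    2 ^+ 43 * 100 ^+ 7 * (trunc_log 2 n).+1%:R ^+ 10 * n%:R ^+ 32 :> R.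
  have cast (a b c d e : nat) : (a ^ 13 <= b ^ 43 * c ^ 7 * d ^ 10 * e ^ 32)%N ->
      a%:R ^+ 13 <= b%:R ^+ 43 * c%:R ^+ 7 * d%:R ^+ 10 * e%:R ^+ 32 :> R.
    by rewrite -(ler_nat R) natrX 3!natrM !natrX.
  apply: cast; rewrite (additive_energyE us sA) -size_s.
  exact: (energy_pow13_le us incidence).
apply: (le_trans E_le); rewrite [leRHS]mulrAC [leRHS]mulrC [leLHS]mulrC.
set P := (L `^ _) ^+ 13 in L_le *; have P_ge0 : 0 <= P by rewrite !exprn_ge0 ?powR_ge0.
have J10_le : (trunc_log 2 n).+1%:R ^+ 10 <= 2 ^+ 10 * P.
  apply: le_trans (_ : (2 * L) ^+ 10 <= _); last first.
    by rewrite exprMn ler_wpM2l ?exprn_ge0.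
  by apply: lerXn2r; rewrite ?nnegrE // (mulr_ge0 _ L_ge0).
have c_le : 100 ^+ 7 <= 2 ^+ 49 :> R.
  rewrite (exprM 2 7 7); apply: lerXn2r; rewrite ?nnegrE ?exprn_ge0 //.
  by rewrite -natrX ler_nat.
rewrite ler_wpM2l ?exprn_ge0 ?ler0n //.
apply: le_trans (_ : 2 ^+ 43 * 2 ^+ 49 * (2 ^+ 10 * P) <= _).
  by apply: ler_pM => //; rewrite ?mulr_ge0 ?exprn_ge0 // ler_wpM2l ?exprn_ge0.
by rewrite (mulrA _ _ P) ler_wpM2r // -!exprD -exprM ler_eXn2l ?ltr1n.
Qed.
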